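(* Let $K$ be a field, $X$ an $m\times n$ matrix of indeterminates, $F:\mathcal D\to\mathbb N$ a KRS-invariant, and let $k$ be an integer. Let $I_k(F)$ be the ideal of $K[X]$ generated by all bitableaux $\Delta$ such that $F(\Delta)\ge k$. Then (a) $I_k(F)$ has a standard basis formed by all standard bitableaux $\Sigma$ such that $F(\Sigma)\ge k$; (b) moreover, $I_k(F)$ is G-KRS.
   Context: A minor is $[a_1,\dots,a_t\mid b_1,\dots,b_t]=\det(X_{a_ib_j})_{1\le i,j\le t}$ with $1\le a_1<\dots<a_t\le m$, $1\le b_1<\dots<b_t\le n$; its size is $t$, and the empty minor is $1$. A bitableau is a product $\Delta=\delta_1\cdots\delta_w$ of minors ordered so that $|\delta_1|\ge\dots\ge|\delta_w|$, where $|\delta|$ is the size of $\delta$; it is written $(a_{ij}\mid b_{ij})$, where $a_{i1}<a_{i2}<\cdots$ and $b_{i1}<b_{i2}<\cdots$ are the row and column indices of $\delta_i$ (row $i$ of the left and right tableau). $\mathcal D$ denotes the set of all bitableaux, identified with products of minors in $K[X]$. Partial order on minors: $[a_1,\dots,a_t\mid b_1,\dots,b_t]\preceq[c_1,\dots,c_u\mid d_1,\dots,d_u]$ iff $t\ge u$ and $a_i\le c_i$, $b_i\le d_i$ for $i=1,\dots,u$. The bitableau is standard if $\delta_1\preceq\dots\preceq\delta_w$. The standard bitableaux form a $K$-basis of $K[X]$; the standard representation of an element is its expression in this basis, and the standard bitableaux appearing in it are those with non-zero coefficient. An ideal has a standard basis if it is the $K$-span of the standard bitableaux contained in it. KRS: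 for a non-empty standard bitableau $\Sigma=(a_{ij}\mid b_{ij})$ let $\ell$ be the largest entry of the left tableau, and let $(p,q)$ be the position with $a_{pq}=\ell$ having largest row index $p$. Remove the boxes at position $(p,q)$ from both tableaux and put $s=b_{pq}$. While $p>1$: in row $p-1$ of the right tableau, replace the rightmost entry that is $\le s$ by $s$, let $s$ be the replaced entry, and replace $p$ by $p-1$. When $p=1$ put $r=s$. The result is a standard bitableau $\Sigma'$ and a pair $(\ell,r)$. Define recursively $\operatorname{KRS}(1)=1$ and $\operatorname{KRS}(\Sigma)=\operatorname{KRS}(\Sigma')X_{\ell r}$. This is a bijection from standard bitableaux to monomials of $K[X]$, and it is extended $K$-linearly to a vector space automorphism $\operatorname{KRS}$ of $K[X]$. Initial terms and ideals are taken with respect to a fixed diagonal term order on $K[X]$, i.e. a term order for which $\operatorname{in}([a_1,\dots,a_t\mid b_1,\dots,b_t])=X_{a_1b_1}\cdots X_{a_tb_t}$ for every minor. An ideal $I$ with a standard basis is in-KRS if $\operatorname{in}(I)=\operatorname{KRS}(I)$, and it is G-KRS if, in addition, the bitableaux $\Delta\in I$ form a Gröbner basis of $I$. For $F:\mathcal D\to\mathbb N$ (with $\mathbb N=\{0,1,2,\dots\}$) and a monomial $M$ of $K[X]$ put $F(M)=\max\{F(\Delta):\Delta\in\mathcal D,\ M=\operatorname{in}(\Delta)\}$. $F$ is a KRS-invariant if: (i) for every bitableau $\Delta$, $F(\Delta)$ is the minimum of $F(\Sigma)$ over the standard bitableaux $\Sigma$ in the standard representation of $\Delta$, and moreover, if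 $\Sigma'$ appears in the standard representation of $x\Delta$ for some $x\in K[X]$, then $F(\Sigma')\ge F(\Delta)$; (ii) $F(\Sigma)=F(\operatorname{KRS}(\Sigma))$ for all standard bitableaux $\Sigma$, where the right-hand side is the value of $F$ on the monomial $\operatorname{KRS}(\Sigma)$. *)

(* Defs.v *)
From HB Require Import structures.
From mathcomp Require Import all_boot all_order all_algebra.
From mathcomp Require Import mpoly.

Set Implicit Arguments.
Unset Strict Implicit.
Unset Printing Implicit Defensive.

Import GRing.Theory.
Local Open Scope ring_scope.

(* Ideals and subspaces of K[X] are handled as predicates A -> Prop.          *)

Definition ideal_gen (A : comNzRingType) (S : A -> Prop) (f : A) : Prop :=
  exists2 s : seq (A * A),
    forall x, x \in s -> S x.2 & f = \sum_(x <- s) x.1 * x.2.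

Definition lin_span (K : fieldType) (V : lmodType K) (S : V -> Prop) (f : V) :
    Prop :=
  exists2 s : seq (K * V),
    forall x, x \in s -> S x.2 & f = \sum_(x <- s) x.1 *: x.2.

Section TermOrders.
Variables (K : fieldType) (N : nat).

(* [ord M M'] reads "M <= M'".                                                *)
Definition term_order (ord : rel 'X_{1..N}) : Prop :=
  [/\ total ord, antisymmetric ord, transitive ord,
      forall M, ord 0%MM M &
      forall M M' P, ord M M' -> ord (M + P)%MM (M' + P)%MM].

(* As for [mlead], the value is 0%MM when p = 0.                              *)
Definition init_mon (ord : rel 'X_{1..N}) (p : {mpoly K[N]}) : 'X_{1..N} :=
  \big[(fun M M' => if ord M M' then M' else M)/0%MM]_(M <- msupp p) M.

Definition init_ideal (ord : rel 'X_{1..N}) (S : {mpoly K[N]} -> Prop) :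
    {mpoly K[N]} -> Prop :=
  ideal_gen (fun g => exists f, [/\ S f, f != 0 & g = 'X_[init_mon ord f]]).

Definition groebner_basis (ord : rel 'X_{1..N})
    (G I : {mpoly K[N]} -> Prop) : Prop :=
  (forall g, G g -> I g) /\
  (forall f, init_ideal ord I f <-> init_ideal ord G f).

End TermOrders.

Section Bitableaux.
Variables m n : nat.

(* The minor [a_1,...,a_t | b_1,...,b_t] is encoded by the sequence of pairs  *)
(* (a_1, b_1), ..., (a_t, b_t), so a bitableau is a tableau whose box (i, j)  *)
(* holds (a_ij, b_ij). Indices start at 0.                                    *)
Local Notation box := ('I_m * 'I_n)%type.
Local Notation row := (seq box).
Local Notation tableau := (seq row).

Definition is_minor (d : row) : bool :=
  sorted (fun x y : box => (x.1 < y.1)%N && (x.2 < y.2)%N) d.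

(* Factors equal to the empty minor 1 are omitted; the bitableau 1 is [::].   *)
Definition is_bitableau (D : tableau) : bool :=
  all (fun d => (d != [::]) && is_minor d) D &&
  sorted (fun d e : row => (size e <= size d)%N) D.

Record bitableau := Bitableau { brows :> tableau; _ : is_bitableau brows }.

HB.instance Definition _ := [isSub for brows].
HB.instance Definition _ := [Choice of bitableau by <:].

(* [zip] truncates to the shorter minor e.                                    *)
Definition minor_le (d e : row) : bool :=
  (size e <= size d)%N &&
  all (fun xy : box * box => (xy.1.1 <= xy.2.1)%N && (xy.1.2 <= xy.2.2)%N)
      (zip d e).

Definition standard (D : tableau) : bool := sorted minor_le D.

(* In the right tableau, replace the rightmost entry of the row d that is     *)
(* <= s by s; the second component is the replaced entry. On standard         *)
(* bitableaux such an entry always exists when [bump] is called.              *)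
Fixpoint bump (d : row) (s : 'I_n) : row * 'I_n :=
  if d is x :: d' then
    if has (fun y : box => (y.2 <= s)%N) d' then
      let: (e, r) := bump d' s in (x :: e, r)
    else if (x.2 <= s)%N then ((x.1, s) :: d', x.2)
    else (d, s)
  else (d, s).

Definition max_left (D : tableau) : nat :=
  \max_(d <- D) \max_(x <- d) x.1.

(* The recursive call handles the rows below d: if one of them contains the   *)
(* left entry l, then s is the right entry coming up into d; otherwise d is   *)
(* the lowest row that may contain l. The result is None if l does not occur. *)
Fixpoint krs_delete (l : nat) (D : tableau) : option (tableau * box) :=
  if D is d :: D' then
    match krs_delete l D' with
    | Some (E, (a, s)) => let: (d', r) := bump d s in Some (d' :: E, (a, r))
    | None =>
        if [seq x : box <- d | x.1 == l :> nat] is x :: _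
        then Some (rem x d :: D', x) else None
    end
  else None.

(* The row emptied when its only box is removed is dropped.                   *)
Definition krs_step (D : tableau) : option (tableau * box) :=
  if krs_delete (max_left D) D is Some (E, x)
  then Some ([seq d <- E | d != [::]], x) else None.

(* The pairs (l, r), in order of extraction; the fuel k bounds the number of  *)
(* boxes.                                                                     *)
Fixpoint krs_pairs (k : nat) (D : tableau) : seq box :=
  if k is k'.+1 then
    if krs_step D is Some (E, x) then x :: krs_pairs k' E else [::]
  else [::].

Definition mon_of (s : seq box) : 'X_{1..m * n} :=
  (\sum_(x <- s) U_(mxvec_index x.1 x.2))%MM.

Definition krs (D : tableau) : 'X_{1..m * n} :=
  mon_of (krs_pairs (size (flatten D)) D).

Section Polynomials.
Variable K : fieldType.

(* The polynomial ring K[X] on the m * n entries of X.                        *)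
Local Notation KX := {mpoly K[m * n]}.

Definition minor_poly (d : row) : KX :=
  \det (\matrix_(i < size d, j < size d)
          'X_(mxvec_index (tnth (in_tuple d) i).1 (tnth (in_tuple d) j).2)).

Definition bpoly (D : tableau) : KX := \prod_(d <- D) minor_poly d.

Definition diagonal (ord : rel 'X_{1..m * n}) : Prop :=
  forall d : row, is_minor d -> init_mon ord (minor_poly d) = mon_of d.

(* The standard representation of f: s lists the standard bitableaux          *)
(* appearing in it, and c gives their coefficients.                           *)
Definition std_repr (f : KX) (s : seq bitableau) (c : bitableau -> K) : Prop :=
  [/\ uniq s, forall S, S \in s -> standard S /\ c S != 0 &
      f = \sum_(S <- s) c S *: bpoly S].

Definition appears (S : bitableau) (f : KX) : Prop :=
  exists s c, std_repr f s c /\ S \in s.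

(* The graph of the linear extension of KRS to K[X].                          *)
Definition krs_graph (f g : KX) : Prop :=
  exists s c, std_repr f s c /\ g = \sum_(S <- s) c S *: 'X_[krs S].

Definition krs_image (I : KX -> Prop) (g : KX) : Prop :=
  exists f, I f /\ krs_graph f g.

Definition has_standard_basis (I : KX -> Prop) : Prop :=
  forall f, I f <->
    lin_span (fun g => exists S : bitableau,
                         [/\ standard S, I (bpoly S) & g = bpoly S]) f.

Definition in_KRS (ord : rel 'X_{1..m * n}) (I : KX -> Prop) : Prop :=
  has_standard_basis I /\ (forall f, init_ideal ord I f <-> krs_image I f).

Definition G_KRS (ord : rel 'X_{1..m * n}) (I : KX -> Prop) : Prop :=
  in_KRS ord I /\
  groebner_basis ord
    (fun g => exists D : bitableau, I (bpoly D) /\ g = bpoly D) I.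

(* [F_mon ord F M v] means F(M) = v, i.e. v is the maximum of the F(D) over   *)
(* the bitableaux D with in(D) = M.                                           *)
Definition F_mon (ord : rel 'X_{1..m * n}) (F : bitableau -> nat)
    (M : 'X_{1..m * n}) (v : nat) : Prop :=
  (exists D : bitableau, init_mon ord (bpoly D) = M /\ F D = v) /\
  (forall D : bitableau, init_mon ord (bpoly D) = M -> (F D <= v)%N).

(* Bitableaux that differ only in the order of factors of equal size are the  *)
(* same product in K[X]; the first condition forces F to agree on them, since *)
(* [appears] only depends on the polynomial.                                  *)
Definition KRS_invariant (ord : rel 'X_{1..m * n}) (F : bitableau -> nat) :
    Prop :=
  [/\ forall D : bitableau,
        (exists S, appears S (bpoly D) /\ F S = F D) /\
        (forall S, appears S (bpoly D) -> (F D <= F S)%N),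
      forall (D S : bitableau) (x : KX),
        appears S (x * bpoly D) -> (F D <= F S)%N &
      forall S : bitableau, standard S -> F_mon ord F (krs S) (F S)].

Definition KRS_ideal (F : bitableau -> nat) (k : int) : KX -> Prop :=
  ideal_gen (fun g => exists D : bitableau, k <= (F D)%:Z /\ g = bpoly D).

End Polynomials.
End Bitableaux.

Arguments KRS_ideal {m n} K F k f.

(* Main.v *)
Require Import Defs.
From mathcomp Require Import all_boot all_order all_algebra.
From mathcomp Require Import mpoly.
From mathcomp Require Import zify.

Set Implicit Arguments.
Unset Strict Implicit.
Unset Printing Implicit Defensive.
Import GRing.Theory.
Local Open Scope ring_scope.

(** Write F(S) for the value of the invariant on a standard bitableau S, and
    I for the ideal I_k(F).

    Condition (i) says in particular that every bitableau, hence every monomial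
    (a product of 1-minors), hence every polynomial is a combination of standard
    bitableaux. Its second half then shows that I is the span of the standard
    bitableaux S with F(S) >= k ([std_span]). What remains is to prove that
    standard bitableaux are linearly independent, so that a standard bitableau in
    I really has F(S) >= k, and that the initial monomials of the elements of I
    are exactly the KRS(S) with S standard and F(S) >= k.

    Both come from one triangularity argument ([krs_triangular]). By (ii), each
    standard S with F(S) >= k comes with a bitableau D_S such that
    in(D_S) = KRS(S) and F(D_S) = F(S). The map KRS is injective ([krs_inj]), so
    the D_S have pairwise distinct initial monomials and are therefore linearly
    independent. By (i) and homogeneity, D_S is a combination of standard
    bitableaux T of the same degree as S, again with F(T) >= k. In bounded degree
    there are finitely many S, and the matrix that expresses the D_S in the T is
    square with independent rows, hence invertible: the S are independent too,
    and the D_S span the same space as the S. A nonzero f in I is thus a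
    combination of the D_S, and as these have distinct initial monomials,
    in(f) = in(D_S) = KRS(S) for some S with F(S) >= k ([init_std_span]). This
    gives in(I) = KRS(I) and the Groebner basis property at once.

    The injectivity of KRS has two parts. A deletion step is undone by row
    insertion ([tab_insert], [krs_deleteP]), so a standard bitableau is determined
    by the sequence of pairs (l, r) that it emits. This sequence is itself
    determined by the monomial, because the pairs come out in a fixed order: l
    decreases weakly, and r increases weakly as long as l is constant
    ([krs_step_order]). *)

(** * Deletion from the right tableau and row insertion *)

Section Rows.
Variables m n : nat.
Local Notation box := ('I_m * 'I_n)%type.
Local Notation row := (seq box).
Local Notation tableau := (seq row).
Local Notation bump := Defs.bump.
Implicit Types (x y z : box) (d e : row) (D E : tableau) (s r : 'I_n).

Local Open Scope nat_scope.

Lemma is_minorP x0 d :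
  reflect (forall i j, i < j < size d ->
             (nth x0 d i).1 < (nth x0 d j).1 /\ (nth x0 d i).2 < (nth x0 d j).2)
          (is_minor d).
Proof.
have tr : transitive (fun x y : box => (x.1 < y.1) && (x.2 < y.2)).
  by move=> y x z /andP[h1 h2] /andP[h3 h4]; apply/andP; lia.
apply: (iffP idP) => [sd i j /andP[ij jd]|sd].
  by apply/andP; apply: (sorted_ltn_nth tr x0 sd) => //; rewrite inE; lia.
apply/(sortedP x0) => i id.
by apply/andP; apply: sd; lia.
Qed.

Lemma minor_leP x0 d e :
  reflect (size e <= size d /\ forall i, i < size e ->
             (nth x0 d i).1 <= (nth x0 e i).1 /\ (nth x0 d i).2 <= (nth x0 e i).2)
          (minor_le d e).
Proof.
apply: (iffP andP) => -[sz H]; split=> //.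
  move=> i ie; move/(all_nthP (x0, x0)): H => /(_ i).
  by rewrite size_zip nth_zip_cond size_zip (minn_idPr sz) ie => /(_ isT)/andP.
apply/(all_nthP (x0, x0)) => i.
rewrite size_zip nth_zip_cond size_zip (minn_idPr sz) => ie.
by rewrite ie; apply/andP/H.
Qed.

Lemma minor_le_trans : transitive (@minor_le m n).
Proof.
move=> d e f; case: f => [|x0 f]; first by case: e => [|? ?] //; case: d.
move=> /(minor_leP x0)[s1 h1] /(minor_leP x0)[s2 h2].
apply/(minor_leP x0); split=> [|i hi]; first exact: leq_trans s1.
have [? ?] := h1 i (leq_trans hi s2); have [? ?] := h2 i hi.
split; lia.
Qed.

Lemma bumpP x0 d s : has (fun y => y.2 <= s) d ->
  exists j, [/\ j < size d, (nth x0 d j).2 <= s,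
    forall i, j < i < size d -> s < (nth x0 d i).2 &
    bump d s = (set_nth x0 d j ((nth x0 d j).1, s), (nth x0 d j).2)].
Proof.
elim: d => //= x d IH; case: ifP => [/IH[j [jd js js' ->]] _|hd].
  exists j.+1; split=> // -[|i] //; exact: js'.
rewrite orbF => xs; rewrite xs; exists 0; split=> // -[|i] //= id.
by rewrite ltnNge; apply: contraFN hd => h; apply/(has_nthP x0); exists i.
Qed.

Lemma bump_lefts d s : map fst (bump d s).1 = map fst d.
Proof.
elim: d => //= x d IH; case: ifP => _; last by case: ifP.
by case: (bump d s) IH => e r /= ->.
Qed.

Lemma size_bump d s : size (bump d s).1 = size d.
Proof. by rewrite -(size_map fst) bump_lefts size_map. Qed.

Lemma bump_minor d s :
  is_minor d -> has (fun y => y.2 <= s) d -> is_minor (bump d s).1.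
Proof.
case: d => // x0 d'; set d := x0 :: d' => /(is_minorP x0) md hs.
have sz := size_bump d s.
have [j [jd js js' eb]] := bumpP x0 hs.
apply/(is_minorP x0) => i k; rewrite sz eb => ik.
have [h1 h2] := md i k ik; rewrite !nth_set_nth /=.
case: (i =P j) ik h1 h2 => [->|ij]; case: (k =P j) => [->|kj] //= ik h1 h2.
- by move: ik; rewrite ltnn.
- by split=> //; exact: js'.
- by split=> //; exact: leq_trans h2 js.
Qed.

(** Row insertion in the sense of Schensted: r replaces the leftmost right entry
    >= r, which is returned; [None] means that there is no such entry, so that r
    belongs at the end of the row. *)
Fixpoint row_insert d r : option (row * 'I_n) :=
  if d is x :: d' then
    if r <= x.2 then Some ((x.1, r) :: d', x.2)
    else if row_insert d' r is Some (e, s) then Some (x :: e, s) else None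
  else None.

Lemma row_insert_nth x0 d r j : j < size d -> r <= (nth x0 d j).2 ->
  (forall i, i < j -> (nth x0 d i).2 < r) ->
  row_insert d r = Some (set_nth x0 d j ((nth x0 d j).1, r), (nth x0 d j).2).
Proof.
elim: d j => //= x d IH [|j] /=; first by move=> _ ->.
move=> jd rj ltr; have := ltr 0 isT; rewrite /= ltnNge => /negPf->.
by rewrite (IH j) // => i ij; apply: (ltr i.+1).
Qed.

Lemma row_insert_None d r :
  (forall x, x \in d -> x.2 < r) -> row_insert d r = None.
Proof.
elim: d => //= x d IH dr; rewrite leqNgt dr ?mem_head //= IH // => y yd.
by apply: dr; rewrite inE yd orbT.
Qed.

(** The entries to the left of the replaced one are smaller than it, and its
    substitute s is at least as large; so insertion meets s first. *)
Lemma row_insert_bump d s :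
  is_minor d -> has (fun y => y.2 <= s) d ->
  row_insert (bump d s).1 (bump d s).2 = Some (d, s).
Proof.
case: d => // x0 d'; set d := x0 :: d' => /(is_minorP x0) md hs.
have sz := size_bump d s.
have [j [jd js js' eb]] := bumpP x0 hs.
have nthb i :
    nth x0 (bump d s).1 i = if i == j then ((nth x0 d j).1, s) else nth x0 d i.
  by rewrite eb /= nth_set_nth.
have -> : (bump d s).2 = (nth x0 d j).2 by rewrite eb.
rewrite (row_insert_nth (x0 := x0) (j := j)) ?sz // ?nthb ?eqxx //.
  congr (Some (_, _)); rewrite eb /= set_set_nth eqxx.
  apply: (@eq_from_nth _ x0) => [|i _].
    by rewrite size_set_nth; apply/maxn_idPr.
  by rewrite nth_set_nth /=; case: eqP => [->|//]; case: (nth x0 d j).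
move=> i ij; rewrite nthb (ltn_eqF ij).
by have [] := md i j; rewrite ?ij.
Qed.

Lemma bump_out d s : has (fun y => y.2 <= s) d -> (bump d s).2 <= s.
Proof. by case: d => // x0 d hs; have [j [_ js _ ->]] := bumpP x0 hs. Qed.

(** Row bumping lemma: once s sits in the row, a later s' >= s can only
    push out an entry >= s. *)
Lemma bump_bump d s s' : has (fun y => y.2 <= s) d -> is_minor d -> s <= s' ->
  (bump d s).2 <= (bump (bump d s).1 s').2.
Proof.
move=> hs md ss'; apply: leq_trans (bump_out hs) _.
have mb := bump_minor md hs.
case: d md mb hs => // x0 d'; set d := x0 :: d' => md /(is_minorP x0) mb hs.
have sz := size_bump d s.
have [j [jd js js' eb]] := bumpP x0 hs.
have nj : nth x0 (bump d s).1 j = ((nth x0 d j).1, s).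
  by rewrite eb /= nth_set_nth /= eqxx.
have hs' : has (fun y => y.2 <= s') (bump d s).1.
  by apply/(has_nthP x0); exists j; rewrite ?sz // nj.
have [k [kd ks ks' ->]] := bumpP x0 hs' => /=.
have [jk|kj|<-] := ltngtP j k; last by rewrite nj.
  by have := mb j k; rewrite jk kd nj => /(_ isT) [_ /ltnW].
by have := ks' j; rewrite kj sz jd nj /= ltnNge ss' => /(_ isT).
Qed.

Lemma last_left_max l d x : is_minor d -> x \in d -> x.1 = l :> nat ->
  (forall y, y \in d -> y.1 <= l) ->
  exists2 d0, d = rcons d0 x & rem x d = d0.
Proof.
move=> md xd xl dl.
have ud : uniq d.
  apply/(uniqPn x) => -[i [j [ij jd e]]].
  have /(is_minorP x)/(_ i j) := md; rewrite ij jd e => /(_ isT) [].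
  by rewrite ltnn.
case/lastP: d md xd dl ud => // d0 z md xd dl ud.
have -> : x = z.
  move: xd; rewrite mem_rcons inE => /orP[/eqP //|xd].
  have /(is_minorP x)/(_ (index x d0) (size d0)) := md.
  rewrite size_rcons ltnSn index_mem xd => /(_ isT)[+ _].
  rewrite !nth_rcons index_mem xd nth_index // ltnn eqxx.
  have := dl z; rewrite mem_rcons mem_head => /(_ isT); lia.
exists d0 => //; rewrite rem_filter // filter_rcons /= eqxx /=.
move: ud; rewrite rcons_uniq => /andP[zd _].
by apply/all_filterP/allP => y yd; apply: contraNneq zd => <-.
Qed.

(** The next two lemmas keep the columns ordered when a deletion moves up by one
    row. Here the lower row has lost its last box, whose right entry x.2 enters
    the row e above: the replaced entry of e cannot lie to the left of the column
    of x. *)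
Lemma minor_le_bump_rcons e d0 x : minor_le e (rcons d0 x) ->
  has (fun y => y.2 <= x.2) e /\ minor_le (bump e x.2).1 d0.
Proof.
move=> /(minor_leP x)[]; rewrite size_rcons => sz le.
have hs : has (fun y => y.2 <= x.2) e.
  apply/(has_nthP x); exists (size d0) => //.
  by have [] := le (size d0) (ltnSn _); rewrite nth_rcons ltnn eqxx.
split=> //; apply/(minor_leP x); rewrite size_bump; split; first exact: ltnW.
move=> i id; have [j [jd js js' ->]] := bumpP x hs.
have [le1 le2] := le i (leqW id); move: le1 le2; rewrite nth_rcons id.
rewrite nth_set_nth /=; case: (i =P j) => [ij|//] le1 le2; rewrite -ij; split=> //=.
have := js' (size d0); rewrite -ij id sz => /(_ isT).
have [] := le (size d0) (ltnSn _); rewrite nth_rcons ltnn eqxx; lia.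
Qed.

(** The bumping path moves weakly to the right on its way up, since the entry of e
    above the replaced entry of d is at most the latter. *)
Lemma minor_le_bump_bump e d s : is_minor d -> has (fun y => y.2 <= s) d ->
  minor_le e d ->
  has (fun y => y.2 <= (bump d s).2) e /\
  minor_le (bump e (bump d s).2).1 (bump d s).1.
Proof.
case: d => // x0 d'; set d := x0 :: d' => /(is_minorP x0) md hs.
move=> /(minor_leP x0)[sz le].
have [j [jd js js' eb]] := bumpP x0 hs; have szb := size_bump d s.
rewrite {}eb /= in szb *.
have hs' : has (fun y => y.2 <= (nth x0 d j).2) e.
  apply/(has_nthP x0); exists j; first exact: leq_trans sz.
  by have [] := le j jd.
split=> //; apply/(minor_leP x0); rewrite size_bump szb; split=> // i.
rewrite -[(size d').+1]/(size d) => id.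
have [k [kd ks ks' ->]] := bumpP x0 hs'.
have jk : j <= k.
  rewrite leqNgt; apply/negP => kj; have := ks' j.
  rewrite kj (leq_trans jd sz) => /(_ isT).
  by have [_] := le j jd; rewrite leqNgt => /negP.
have [le1 le2] := le i id; rewrite !nth_set_nth /=.
case: (i =P k) => [ik|ik]; case: (i =P j) => [ij|ij]; split=> //=.
- by rewrite -ij -ik.
- by rewrite -ik.
- by have [|_ /ltnW //] := md j i; lia.
- by rewrite -ij.
- by rewrite ij in le2 *; apply: leq_trans js.
Qed.

(** The inverse of a deletion step. Only the right entries travel; the left
    entry x.1 is carried along and ends up in the new box. *)
Fixpoint tab_insert D (x : box) : tableau :=
  if D is d :: D' then
    if row_insert d x.2 is Some (d', s) then d' :: tab_insert D' (x.1, s)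
    else rcons d x :: D'
  else [:: [:: x]].

Lemma krs_delete_None l D :
  krs_delete l D = None -> forall y, y \in flatten D -> y.1 != l :> nat.
Proof.
elim: D => //= d D IH; case: (krs_delete l D) IH => [[E [a s]]|] IH.
  by case: (bump d s).
case Ef: [seq x <- d | _] => [|//] _ y; rewrite mem_cat.
case/orP=> [yd|]; last exact: IH.
by apply/negP => yl; have: y \in [::] by rewrite -Ef mem_filter yl.
Qed.

Lemma krs_delete_Some l D E x : krs_delete l D = Some (E, x) ->
  x.1 = l :> nat /\ exists2 y, y \in flatten D & y.1 = l :> nat.
Proof.
elim: D E x => //= d D IH E x; case: (krs_delete l D) IH => [[E' [a s]]|] IH.
  have [al [y yD yl]] := IH E' (a, s) erefl.
  case: (bump d s) => d' r [_ <-]; split=> //.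
  by exists y => //; rewrite mem_cat yD orbT.
case Ef: [seq x <- d | _] => [//|z f] [_ <-].
have: z \in [seq x : box <- d | x.1 == l :> nat] by rewrite Ef mem_head.
rewrite mem_filter => /andP[/eqP zl zd]; split=> //.
by exists z; rewrite ?mem_cat ?zd.
Qed.

Definition proper_rows D := all (fun d => (d != [::]) && is_minor d) D.

(** Deletion is undone by insertion. The last clause is what the induction passes
    to the row above: whatever row e fits on top of D still fits on top of the
    result after it has been bumped. Rows emptied by the deletion stay in E, as
    [krs_step] removes them only afterwards. *)
Lemma krs_deleteP l D E x :
    proper_rows D -> sorted (@minor_le m n) D ->
    (forall y, y \in flatten D -> y.1 <= l) -> krs_delete l D = Some (E, x) ->
  [/\ all (@is_minor m n) E, sorted (@minor_le m n) E,
      (size (flatten E)).+1 = size (flatten D),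
      forall y, y \in flatten E -> y.1 <= l &
      tab_insert [seq d <- E | d != [::]] x = D /\
      forall e, minor_le e (head [::] D) ->
        has (fun y => y.2 <= x.2) e /\
        minor_le (bump e x.2).1 (head [::] E)].
Proof.
elim: D E x => //= d D IH E x /andP[/andP[d0 md] mD] dD Dl.
have hD : D != [::] -> minor_le d (head [::] D).
  by case: (D) dD => //= ? ? /andP[].
have {}dD : sorted (@minor_le m n) D by exact: path_sorted dD.
have dl y : y \in d -> y.1 <= l by move=> yd; apply: Dl; rewrite mem_cat yd.
have {}Dl y : y \in flatten D -> y.1 <= l.
  by move=> yd; apply: Dl; rewrite mem_cat yd orbT.
case ED: (krs_delete l D) => [[E' [a s]]|].
  have [mE sE szE El [IE hE]] := IH _ _ mD dD Dl ED.
  have D0 : D != [::] by case: (D) ED.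
  have [hs led] := hE d (hD D0).
  case Eb: (bump d s) => [d' r] [<- <-] /=.
  have Ed' : d' = (bump d s).1 by rewrite Eb.
  have Er : r = (bump d s).2 by rewrite Eb.
  have szd' : size d' = size d by rewrite Ed' size_bump.
  split.
  - by rewrite mE Ed' bump_minor.
  - by rewrite /= Ed'; case: (E') led sE => //= ? ? -> ->.
  - by rewrite !size_cat szd' -szE addnS.
  - move=> y; rewrite mem_cat => /orP[yd|]; last exact: El.
    have: y.1 \in map fst d' by apply: map_f.
    by rewrite Ed' bump_lefts => /mapP[z zd ->]; apply: dl.
  - have -> : d' != [::] by rewrite -size_eq0 szd' size_eq0.
    rewrite /= {1}Ed' {1}Er row_insert_bump // IE; split=> // e.
    rewrite Ed' Er; exact: minor_le_bump_bump.
have Dn := krs_delete_None ED.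
case Ef: [seq x <- d | _] => [//|z f] [<- <-].
have: z \in [seq x : box <- d | x.1 == l :> nat] by rewrite Ef mem_head.
rewrite mem_filter => /andP[/eqP zl zd].
have [d1 dE ->] := last_left_max md zd zl dl; rewrite dE in md hD d0 *.
(* If the row below were as long as d, its last box would lie under z and
   have left entry >= l, although l does not occur below d. *)
have szD : size (head [::] D) <= size d1 /\ minor_le d1 (head [::] D).
  case: (D) hD Dn Dl => [|d' D'] //=; first by case: (d1).
  move=> /(_ isT)/(minor_leP z)[].
  rewrite size_rcons leq_eqVlt => /orP[/eqP sz|sz] le Dn Dl.
    have z'd : nth z d' (size d1) \in d' ++ flatten D'.
      by rewrite mem_cat mem_nth // sz.
    have := le (size d1); rewrite sz ltnSn nth_rcons ltnn eqxx => /(_ isT)[].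
    have := Dn _ z'd; have := Dl _ z'd; lia.
  split=> //; apply/(minor_leP z); split=> // i id'.
  by have := le i id'; rewrite nth_rcons (leq_trans id' sz).
split=> /=.
- rewrite [is_minor d1](cat_sorted2 (s' := [:: z])) ?cats1 //=.
  by apply: sub_all mD => e /andP[].
- by case: (D) szD dD => //= ? ? [_ ->].
- by rewrite !size_cat size_rcons.
- move=> y; rewrite mem_cat => /orP[yd|]; last exact: Dl.
  by apply: dl; rewrite dE mem_rcons inE yd orbT.
- split; last by move=> e; exact: minor_le_bump_rcons.
  have fD : [seq d <- D | d != [::]] = D.
    by apply/all_filterP; apply: sub_all mD => e /andP[].
  rewrite fD; case: d1 szD md {hD dE d0} => [|y d1] [szD _] md /=.
    by case: (D) szD mD => //= d' ?; rewrite leqn0 size_eq0 => ->.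
  suff /= -> : row_insert (y :: d1) z.2 = None by [].
  apply: row_insert_None => w /(nthP z)[i id <-].
  have /(is_minorP z)/(_ i (size (y :: d1))) := md.
  by rewrite size_rcons !nth_rcons id ltnn eqxx ltnSn => /(_ isT)[].
Qed.

(** Each row contains l at most once, so the second deletion starts in a higher
    row than the first, with the last entry of that row; from there on the row
    bumping lemma keeps its output at least that of the first. *)
Lemma krs_delete_order l D E x E2 y :
    proper_rows D -> sorted (@minor_le m n) D ->
    (forall y, y \in flatten D -> y.1 <= l) ->
    krs_delete l D = Some (E, x) ->
    krs_delete l [seq d <- E | d != [::]] = Some (E2, y) -> x.2 <= y.2.
Proof.
elim: D E x E2 y => //= d D IH E x E2 y /andP[/andP[d0 md] mD] dD Dl.
have hD : D != [::] -> minor_le d (head [::] D).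
  by case: (D) dD => //= ? ? /andP[].
have {}dD : sorted (@minor_le m n) D by exact: path_sorted dD.
have dl y' : y' \in d -> y'.1 <= l by move=> yd; apply: Dl; rewrite mem_cat yd.
have {}Dl y' : y' \in flatten D -> y'.1 <= l.
  by move=> yd; apply: Dl; rewrite mem_cat yd orbT.
case ED: (krs_delete l D) => [[E' [a s]]|].
  have [mE sE szE El [IE hE]] := krs_deleteP mD dD Dl ED.
  have D0 : D != [::] by case: (D) ED.
  have [hs led] := hE d (hD D0).
  have bo := bump_out hs; have bb := bump_bump hs md; have bm := bump_minor md hs.
  have bs := size_bump d s; have bl := bump_lefts d s.
  case Eb: (bump d s) bo bb bm bs bl => [d' r] /= bo bb bm bs bl [<- <-] /=.
  have -> : d' != [::] by rewrite -size_eq0 bs size_eq0.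
  rewrite /=; case EE: (krs_delete l _) => [[E2' [a' s']]|].
    have ss' := IH _ _ _ _ mD dD Dl ED EE.
    by have := bb _ ss'; case: (bump d' s') => ? ? /= ? [_ <-].
  case Ef: [seq x <- d' | _] => [//|z f] [_ <-] /=; apply: leq_trans bo _.
  have: z \in [seq x : box <- d' | x.1 == l :> nat] by rewrite Ef mem_head.
  rewrite mem_filter => /andP[/eqP zl zd].
  have [|d1 dE _] := last_left_max bm zd zl.
    move=> w wd; have: w.1 \in map fst d' by apply: map_f.
    by rewrite bl => /mapP[z' z'd ->]; apply: dl.
  have [j [jd js js' eb]] := bumpP z hs.
  have nj : (nth z d' j).2 = s.
    by have := congr1 fst eb; rewrite Eb /= => ->; rewrite nth_set_nth /= eqxx.
  move: jd nj; rewrite -bs dE size_rcons ltnS leq_eqVlt => /orP[/eqP->|jd].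
    by rewrite nth_rcons ltnn eqxx => ->.
  have /(is_minorP z)/(_ j (size d1)) := bm.
  by rewrite dE size_rcons !nth_rcons jd ltnn eqxx ltnSn => /(_ isT)[_ /ltnW] + <-.
have Dn := krs_delete_None ED.
case Ef: [seq x <- d | _] => [//|z f] [<- <-].
have: z \in [seq x : box <- d | x.1 == l :> nat] by rewrite Ef mem_head.
rewrite mem_filter => /andP[/eqP zl zd].
have [d1 dE ->] := last_left_max md zd zl dl.
move=> /krs_delete_Some[_ [w]].
have fE : flatten [seq d <- d1 :: D | d != [::]] = d1 ++ flatten D.
  suff: forall F : tableau, flatten [seq d <- F | d != [::]] = flatten F by move->.
  by elim=> //= -[|? ?] F /= ->.
rewrite fE mem_cat => /orP[wd|/Dn/eqP //] wl.
have [i id iw] := nthP z wd.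
have /(is_minorP z)/(_ i (size d1)) := md.
rewrite dE size_rcons !nth_rcons id ltnn eqxx ltnSn iw => /(_ isT)[].
by rewrite wl zl ltnn.
Qed.

End Rows.

(** * Injectivity of KRS *)

Section Krs.
Variables m n : nat.
Local Notation box := ('I_m * 'I_n)%type.
Local Notation row := (seq box).
Local Notation tableau := (seq row).
Implicit Types (x y z : box) (d e : row) (D E : tableau).
Local Open Scope nat_scope.

Definition standard_tab D := proper_rows D && sorted (@minor_le m n) D.

Lemma standard_tabP (S : bitableau m n) : standard S -> standard_tab S.
Proof.
by case: S => D /= /andP[pD _] sD; rewrite /standard_tab /proper_rows pD.
Qed.

Lemma leq_max_left D y : y \in flatten D -> y.1 <= max_left D.
Proof.
move=> /flattenP[d dD yd]; apply: (bigmaxn_sup_seq d dD) => //.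
exact: (bigmaxn_sup_seq y yd).
Qed.

Lemma max_left_mem D : flatten D != [::] ->
  exists2 y, y \in flatten D & y.1 = max_left D :> nat.
Proof.
rewrite /max_left -(@big_flatten _ _ _ _ _ xpredT (fun y : box => y.1 : nat)).
elim: (flatten D) => //= x s IH _; rewrite big_cons.
case: s IH => [|z s] IH; first by exists x; rewrite ?mem_head ?big_nil ?maxn0.
have [//|y ys <-] := IH; have [le|lt] := leqP y.1 x.1.
  by exists x; rewrite ?mem_head //.
by exists y; rewrite 1?inE ?ys ?orbT.
Qed.

Lemma krs_step_Some D E x : standard_tab D -> krs_step D = Some (E, x) ->
  [/\ standard_tab E, (size (flatten E)).+1 = size (flatten D),
      tab_insert E x = D, x.1 = max_left D :> nat & max_left E <= x.1].
Proof.
case/andP=> pD sD; rewrite /krs_step.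
case ED: (krs_delete _ D) => [[E' x']|//] [<- <-].
have [xl _] := krs_delete_Some ED.
have [mE sE szE El [IE _]] := krs_deleteP pD sD (@leq_max_left D) ED.
have fE : flatten [seq d <- E' | d != [::]] = flatten E'.
  by elim: (E') => //= -[|? ?] F /= ->.
split; rewrite ?fE //.
- apply/andP; split; last by rewrite sorted_filter //; exact: minor_le_trans.
  apply/allP => d; rewrite mem_filter => /andP[-> dE] /=.
  exact: (allP mE).
- rewrite xl; have [f0|f0] := eqVneq (flatten E') [::].
    rewrite [max_left _]big_seq big1 // => -[|z d]; rewrite mem_filter //= => dE.
    have: z \in flatten E' by apply/flattenP; exists (z :: d); rewrite ?mem_head.
    by rewrite f0.
  have [|y] := @max_left_mem [seq d <- E' | d != [::]]; first by rewrite fE.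
  by rewrite fE => yE <-; exact: El.
Qed.

Lemma krs_step_None D : krs_step D = None -> flatten D = [::].
Proof.
rewrite /krs_step; case ED: (krs_delete _ D) => [[E x]|] // _.
apply/eqP; apply: contraT => /max_left_mem[y yD yl].
by have := krs_delete_None ED yD; rewrite yl eqxx.
Qed.

(** The order in which pairs are emitted; being antisymmetric, it makes the
    emitted sequence recoverable from the multiset of its pairs. *)
Definition krs_order x y := (y.1 < x.1) || (x.1 == y.1) && (x.2 <= y.2).

Lemma krs_step_order D E x E2 y : standard_tab D ->
  krs_step D = Some (E, x) -> krs_step E = Some (E2, y) -> krs_order x y.
Proof.
move=> sD eD eE; have [sE _ _ xl mx] := krs_step_Some sD eD.
have [_ _ _ yl _] := krs_step_Some sE eE.
rewrite /krs_order; have [//|xy /=] := ltnP y.1 x.1.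
have e : max_left E = max_left D by apply/eqP; rewrite eqn_leq -{1}xl mx -yl -xl.
have -> : x.1 == y.1 by rewrite -val_eqE /= xl yl e.
case/andP: sD => pD oD; move: eD eE; rewrite /krs_step e.
case ED: (krs_delete _ D) => [[E' x']|//] [<- <-].
case EE: (krs_delete _ _) => [[E2' y']|//] [_ <-].
exact: krs_delete_order pD oD (@leq_max_left D) ED EE.
Qed.

Lemma size_krs_pairs k D :
  standard_tab D -> size (flatten D) = k -> size (krs_pairs k D) = k.
Proof.
elim: k D => //= k IH D sD szD; case ED: (krs_step D) => [[E x]|]; last first.
  by rewrite (krs_step_None ED) in szD.
have [sE szE _ _ _] := krs_step_Some sD ED.
by rewrite /= IH //; apply: succn_inj; rewrite szE.
Qed.

Lemma sorted_krs_pairs k D : standard_tab D -> sorted krs_order (krs_pairs k D).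
Proof.
elim: k D => //= k IH D sD; case ED: (krs_step D) => [[E x]|] //.
have [sE _ _ _ _] := krs_step_Some sD ED.
have := IH E sE; case: k {IH} => //= k; case EE: (krs_step E) => [[E2 y]|] //= ->.
by rewrite (krs_step_order sD ED EE).
Qed.

Lemma krs_pairs_inj k D E : standard_tab D -> standard_tab E ->
  size (flatten D) = k -> size (flatten E) = k ->
  krs_pairs k D = krs_pairs k E -> D = E.
Proof.
elim: k D E => [|k IH] D E sD sE.
  have nil F : standard_tab F -> size (flatten F) = 0 -> F = [::].
    by case: F => // -[|? ?] F.
  by move=> /(nil _ sD)-> /(nil _ sE)->.
move=> szD szE /=.
case ED: (krs_step D) => [[D' x]|]; last by rewrite (krs_step_None ED) in szD.
case EE: (krs_step E) => [[E' y]|]; last by rewrite (krs_step_None EE) in szE.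
have [sD' szD' <- _ _] := krs_step_Some sD ED.
have [sE' szE' <- _ _] := krs_step_Some sE EE.
case=> <- /(IH _ _ sD' sE') -> //; apply: succn_inj; rewrite ?szD' ?szE' //.
Qed.

Lemma krs_order_trans : transitive krs_order.
Proof. by move=> y x z; rewrite /krs_order -!val_eqE /=; lia. Qed.

Lemma krs_order_anti : antisymmetric krs_order.
Proof.
move=> [a b] [c d]; rewrite /krs_order -!val_eqE /= => h.
by congr pair; apply: val_inj => /=; lia.
Qed.

Lemma mon_ofE (s : row) i j : mon_of s (mxvec_index i j) = count_mem (i, j) s.
Proof.
rewrite /mon_of mnm_sumE -sum1_count [RHS]big_mkcond; apply: eq_bigr => -[a b] _ /=.
rewrite mnm1E -val_eqE /= -[LHS]/(nat_of_bool (_ == _)).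
have -> : (mxvec_index a b == mxvec_index i j :> nat) = ((a, b) == (i, j)).
  rewrite val_eqE; apply/eqP/eqP => [e|[-> ->] //].
  have [g gK _] := curry_mxvec_bij m n.
  by rewrite -(gK (a, b) isT) -(gK (i, j) isT) /= e.
by case: eqP.
Qed.

Lemma mon_of_perm (s t : row) : mon_of s = mon_of t -> perm_eq s t.
Proof. by move=> e; apply/allP => -[i j] _ /=; rewrite -!mon_ofE e. Qed.

Lemma mdeg_mon_of (s : row) : mdeg (mon_of s) = size s.
Proof. by rewrite mdeg_sum -sum1_size; apply: eq_bigr => x _; exact: mdeg1. Qed.

Lemma mdeg_krs D : standard_tab D -> mdeg (krs D) = size (flatten D).
Proof. by move=> sD; rewrite mdeg_mon_of size_krs_pairs. Qed.

(** The monomial fixes the multiset of emitted pairs, the emission order arranges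
    them in a sequence, and insertion rebuilds the bitableau from the sequence. *)
Theorem krs_inj (S T : bitableau m n) :
  standard S -> standard T -> krs S = krs T -> S = T.
Proof.
move=> /standard_tabP sS /standard_tabP sT e.
have szST : size (flatten S) = size (flatten T) by rewrite -!mdeg_krs ?e.
apply: val_inj; apply: (krs_pairs_inj sS sT erefl (esym szST)).
move/mon_of_perm: e; rewrite -szST => e.
apply: (sorted_eq (@krs_order_trans) (@krs_order_anti)) => //;
  exact: sorted_krs_pairs.
Qed.

End Krs.

(** * Spans and families *)

Section LinSpan.
Variables (K : fieldType) (V : lmodType K).
Implicit Types (P : V -> Prop) (f g : V) (c : K).

Lemma lin_spanD P f g : lin_span P f -> lin_span P g -> lin_span P (f + g).
Proof.
move=> [s Ps ->] [t Pt ->]; exists (s ++ t); last by rewrite big_cat.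
by move=> x; rewrite mem_cat => /orP[/Ps|/Pt].
Qed.

Lemma lin_spanZ P c f : lin_span P f -> lin_span P (c *: f).
Proof.
move=> [s Ps ->]; exists [seq (c * x.1, x.2) | x <- s].
  by move=> _ /mapP[x xs ->]; exact: (Ps x).
by rewrite scaler_sumr big_map; apply: eq_bigr => x _; rewrite scalerA.
Qed.

Lemma lin_span_sum P (I : eqType) (r : seq I) (G : I -> V) :
  (forall i, i \in r -> lin_span P (G i)) -> lin_span P (\sum_(i <- r) G i).
Proof.
move=> PG; rewrite big_seq; apply: big_ind => //; [|exact: lin_spanD].
by exists [::]; rewrite ?big_nil.
Qed.

Lemma lin_span_gen P f : P f -> lin_span P f.
Proof.
move=> Pf; exists [:: (1, f)]; last by rewrite big_seq1 scale1r.
by move=> x; rewrite inE => /eqP->.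
Qed.

Lemma lin_span_sub P (Q : V -> Prop) f :
  (forall g, P g -> Q g) -> lin_span P f -> lin_span Q f.
Proof. by move=> PQ [s Ps ->]; exists s => // x /Ps/PQ. Qed.

(** A combination of members of a family, collected into distinct indices with
    nonzero coefficients; [phi] need not be injective. *)
Lemma lin_span_family (T : choiceType) (phi : T -> V) (Q : T -> Prop) f :
  lin_span (fun g => exists2 t, Q t & g = phi t) f ->
  exists (s : seq T) (c : T -> K),
    [/\ uniq s, forall t, t \in s -> Q t /\ c t != 0 &
        f = \sum_(t <- s) c t *: phi t].
Proof.
case=> l Pl ->.
have [l' Ql ->] : exists2 l' : seq (K * T), forall x, x \in l' -> Q x.2 &
    \sum_(x <- l) x.1 *: x.2 = \sum_(x <- l') x.1 *: phi x.2.
  elim: l Pl => [|x l IH] Pl; first by exists [::]; rewrite ?big_nil.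
  have [|l' Ql lE] := IH.
    by move=> y yl; apply: Pl; rewrite inE yl orbT.
  have [t Qt xE] := Pl x (mem_head _ _).
  exists ((x.1, t) :: l'); last by rewrite !big_cons xE lE.
  by move=> y; rewrite inE => /orP[/eqP->|/Ql].
pose c t := \sum_(x <- l' | x.2 == t) x.1.
exists [seq t <- undup (map snd l') | c t != 0], c; split.
- by rewrite filter_uniq ?undup_uniq.
- move=> t; rewrite mem_filter mem_undup => /andP[-> /mapP[x xl ->]].
  by split=> //; exact: Ql.
rewrite big_filter [RHS]big_rmcond; last first.
  by move=> t /negPn/eqP->; rewrite scale0r.
under [RHS]eq_bigr => t _ do rewrite scaler_suml big_mkcond.
rewrite exchange_big big_seq [RHS]big_seq; apply: eq_bigr => x xl.
rewrite (bigD1_seq x.2) ?undup_uniq ?mem_undup ?map_f //= eqxx big1 ?addr0 //.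
by move=> t; rewrite eq_sym => /negPf->.
Qed.

End LinSpan.

Section FreeFamilies.
Variables (K : fieldType) (V : lmodType K) (k : nat).

Definition free_family (g : 'I_k -> V) :=
  forall u : 'I_k -> K, \sum_i u i *: g i = 0 -> forall i, u i = 0.

(** A free family cannot be expressed by a dependent family of the same size: the
    coefficient matrix has independent rows, so it is invertible. *)
Lemma free_family_basis (g h : 'I_k -> V) (A : 'I_k -> 'I_k -> K) :
    free_family g -> (forall i, g i = \sum_j A i j *: h j) ->
  free_family h /\
  exists B : 'I_k -> 'I_k -> K, forall i, h i = \sum_j B i j *: g j.
Proof.
move=> free_g gE; pose M : 'M_k := \matrix_(i, j) A i j.
have mulM (u : 'rV_k) : \sum_i u 0 i *: g i = \sum_j (u *m M) 0 j *: h j.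
  under eq_bigr => i _ do rewrite gE scaler_sumr.
  rewrite exchange_big; apply: eq_bigr => j _ /=.
  rewrite mxE scaler_suml; apply: eq_bigr => i _.
  by rewrite mxE scalerA.
have uM : M \in unitmx.
  rewrite -row_free_unit; apply: inj_row_free => u u0; apply/rowP => i.
  rewrite mxE; apply: free_g (fun i => u 0 i) _ i.
  by rewrite mulM u0 big1 // => j _; rewrite mxE scale0r.
have mulV (u : 'rV_k) : \sum_i u 0 i *: h i = \sum_j (u *m invmx M) 0 j *: g j.
  by rewrite mulM mulmxKV.
split.
  move=> u u0 i.
  have /rowP/(_ i) : \row_i u i = 0 :> 'rV_k; last by rewrite !mxE.
  rewrite -[LHS](mulmxKV uM) -[RHS](mul0mx _ M); congr (_ *m _).
  apply/rowP => j; rewrite [RHS]mxE.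
  apply: (free_g (fun j => (\row_i u i *m invmx M) 0 j)).
  by rewrite -mulV -[RHS]u0; apply: eq_bigr => l _; rewrite mxE.
exists (fun i j => invmx M i j) => i.
have := mulV (delta_mx 0 i); rewrite (bigD1 i) //= mxE !eqxx scale1r big1.
  by rewrite addr0 => ->; apply: eq_bigr => j _; rewrite -rowE mxE.
by move=> j /negPf ji; rewrite mxE ji andbF scale0r.
Qed.

End FreeFamilies.

(** * Initial monomials *)

Section InitialMonomials.
Variables (K : fieldType) (N : nat) (ord : rel 'X_{1..N}).
Hypothesis ord_term : term_order ord.
Implicit Types (f p : {mpoly K[N]}) (M : 'X_{1..N}).

Let ord_refl : reflexive ord.
Proof.
by move=> M; case: ord_term => tot _ _ _ _; have := tot M M; rewrite orbb.
Qed.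

Lemma init_mon_max f : f != 0 ->
  init_mon ord f \in msupp f /\ forall M, M \in msupp f -> ord M (init_mon ord f).
Proof.
have [tot anti trans ord0 _] := ord_term.
rewrite -msupp_eq0 /init_mon; elim: (msupp f) => //= M s IH _.
rewrite big_cons; have [->|/IH[vs sv]] := eqVneq s [::].
  rewrite big_nil; split; last by move=> M'; rewrite inE => /eqP->; case: ifP.
  case: ifP => [M0|_]; last exact: mem_head.
  by rewrite (anti M 0%MM) ?mem_head // M0 ord0.
case: ifP => Mv; split; rewrite ?mem_head ?inE ?vs ?orbT // => M'.
  by rewrite inE => /orP[/eqP->//|]; exact: sv.
rewrite inE => /orP[/eqP->//|/sv h]; apply: trans h _.
by have := tot M (\big[(fun M M' => if ord M M' then M' else M)/0%MM]_(M <- s) M);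
  rewrite Mv.
Qed.

Lemma init_mon_eq f M : M \in msupp f ->
  (forall M', M' \in msupp f -> ord M' M) -> init_mon ord f = M.
Proof.
move=> Mf fM; have [_ anti _ _ _] := ord_term.
have [|vf fv] := @init_mon_max f.
  by rewrite -msupp_eq0; apply: contraTneq Mf => ->.
by apply: anti; rewrite fM ?fv.
Qed.

Lemma init_monMX f M :
  f != 0 -> init_mon ord (f * 'X_[M]) = (M + init_mon ord f)%MM.
Proof.
have [_ _ _ _ ordD] := ord_term.
move=> /init_mon_max[vf fv]; apply: init_mon_eq => [|M'];
  rewrite (perm_mem (msuppMX _ _)); first exact: map_f.
by move=> /mapP[M1 /fv h ->]; rewrite ![(M + _)%MM]addmC; apply: ordD.
Qed.

(** The largest of the distinct initial monomials that occur cannot cancel. *)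
Lemma init_mon_comb k (p : 'I_k -> {mpoly K[N]}) (u : 'I_k -> K) :
    (forall i, p i != 0) -> injective (fun i => init_mon ord (p i)) ->
    (exists i, u i != 0) ->
  exists i, [/\ u i != 0, \sum_i u i *: p i != 0 &
                init_mon ord (\sum_i u i *: p i) = init_mon ord (p i)].
Proof.
move=> p0 inj [i0 ui0]; have [tot anti trans _ _] := ord_term.
have := @extremumP _ _ (fun x y => ord y x) i0 (fun i => u i != 0)
  (fun i => init_mon ord (p i)) ord_refl _ _ ui0.
case=> [y x z xy yz|x y|i ui max_i]; first exact: trans yz xy.
  exact: tot.
set f := \sum_i u i *: p i; set M := init_mon ord (p i).
have fM : f@_M != 0.
  rewrite /f raddf_sum /= (bigD1 i) //= big1 ?addr0.
    rewrite mcoeffZ mulf_neq0 // -mcoeff_msupp.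
    by have [] := init_mon_max (p0 i).
  move=> j ji; rewrite mcoeffZ; have [->|uj] := eqVneq (u j) 0.
    by rewrite mul0r.
  apply/eqP; rewrite mulf_eq0 (negPf uj) /=; apply: contraR ji.
  rewrite -mcoeff_msupp => Mj; apply/eqP/inj/anti => /=.
  by rewrite (max_i j uj); have [_ ->] := init_mon_max (p0 j).
exists i; split=> //; first by apply: contraNneq fM => ->; rewrite mcoeff0.
apply: init_mon_eq => [|M'].
  by rewrite mcoeff_msupp.
move=> /msupp_sum_le/flattenP[_ /mapP[j _ ->]] jM'.
have [uj|uj] := eqVneq (u j) 0; first by move: jM'; rewrite uj scale0r msupp0.
have [_ /(_ _ (msuppZ_le jM')) h] := init_mon_max (p0 j).
by apply: trans h _; exact: max_i.
Qed.

End InitialMonomials.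

(** * Bitableaux as polynomials *)

Section BitableauPolynomials.
Variables (K : fieldType) (m n : nat).
Local Notation box := ('I_m * 'I_n)%type.
Local Notation tableau := (seq (seq box)).
Local Notation KX := {mpoly K[m * n]}.

Lemma minor_poly_homog (d : seq box) : minor_poly K d \is (size d).-homog.
Proof.
apply: rpred_sum => s _; rewrite -signr_odd mulr_sign.
set p : KX := \prod_i _.
suff: p \is (size d).-homog by case: ifP; rewrite ?rpredN.
rewrite /p; under eq_bigr => i _ do rewrite mxE.
rewrite mprodXE dhomogX /= mdeg_sum.
by rewrite (eq_bigr (fun=> 1%N)) ?sum1_card ?card_ord // => i _; rewrite mdeg1.
Qed.

Lemma bpoly_homog (D : tableau) : bpoly K D \is (size (flatten D)).-homog.
Proof.
rewrite /bpoly; elim: D => [|d D IH] /=; first by rewrite big_nil dhomog1.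
by rewrite big_cons size_cat; apply: dhomogM => //; exact: minor_poly_homog.
Qed.

(** A diagonal order gives a nonempty minor a monomial of positive degree as its
    initial monomial, whereas [init_mon] sends 0 to the monomial 1. *)
Lemma bpoly_neq0 (ord : rel 'X_{1..m * n}) (D : bitableau m n) :
  diagonal K ord -> bpoly K D != 0.
Proof.
move=> diag; case: D => D /= /andP[pD _]; rewrite /bpoly big_seq.
rewrite prodf_seq_neq0; apply/allP => d _; apply/implyP => dD.
have /andP[d0 md] := allP pD d dD; apply: contraNneq d0 => p0.
have := diag d md; rewrite p0 /init_mon msupp0 big_nil => /(congr1 mdeg).
by rewrite mdeg0 mdeg_mon_of => /esym/eqP; rewrite size_eq0.
Qed.

Lemma mdeg_init_bpoly (ord : rel 'X_{1..m * n}) (D : bitableau m n) :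
  term_order ord -> diagonal K ord ->
  mdeg (init_mon ord (bpoly K D)) = size (flatten D).
Proof.
move=> term diag; have [vD _] := init_mon_max term (bpoly_neq0 D diag).
exact: (dhomog_mf (bpoly_homog D) vD).
Qed.

Lemma mpolyX_bitableau (M : 'X_{1..m * n}) :
  exists D : bitableau m n, bpoly K D = 'X_[M].
Proof.
suff [D sD DE] : exists2 D : tableau,
    all (fun d => size d == 1%N) D & bpoly K D = 'X_[M].
  have bD : is_bitableau D.
    apply/andP; split; first by apply: sub_all sD => -[|x []].
    elim: D sD {DE} => //= d D IH /andP[/eqP sd sD].
    rewrite path_min_sorted ?IH //; apply: sub_all sD => e /eqP.
    by rewrite sd => ->.
  by exists (Bitableau bD).
rewrite mpolyXE_id; apply: (big_ind (fun p : KX => exists2 D : tableau,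
    all (fun d => size d == 1%N) D & bpoly K D = p))
  => [|p q [D sD <-] [E sE <-]|k _].
- by exists [::]; rewrite // /bpoly big_nil.
- by exists (D ++ E); rewrite ?all_cat ?sD // /bpoly big_cat.
case/mxvec_indexP: k => i j.
exists (nseq (M (mxvec_index i j)) [:: (i, j)]); first by rewrite all_nseq orbT.
rewrite /bpoly big_nseq -/(_ ^+ _) /minor_poly.
by rewrite iter_mulr_1 det_mx11 mxE.
Qed.

(** Removing the first box lowers the number of boxes; the removed box either was
    a row of its own or is put back in front of the first row. *)
Lemma bounded_tableaux (d : nat) : exists L : seq tableau,
  forall D, all (predC1 [::]) D -> (size (flatten D) <= d)%N -> D \in L.
Proof.
elim: d => [|d [L hL]].
  by exists [:: [::]] => -[|[|x r] D].
exists ([::] :: allpairs (fun x D => [:: x] :: D) (enum {: box}) L ++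
  allpairs (fun x D => (x :: head [::] D) :: behead D) (enum {: box}) L).
case=> [|[|x r] D] //= pD szD; rewrite inE mem_cat; apply/orP; right.
case: r szD => [|y r] szD; apply/orP; [left|right].
  by apply: allpairs_f; rewrite ?mem_enum ?hL.
by apply: (allpairs_f _ (y := (y :: r) :: D)); rewrite ?mem_enum ?hL.
Qed.

Lemma bounded_bitableaux (d : nat) : exists L : seq (bitableau m n),
  uniq L /\ forall S, (size (flatten (brows S)) <= d)%N -> S \in L.
Proof.
have [L hL] := bounded_tableaux d; exists (undup (pmap insub L)).
rewrite undup_uniq; split=> // S szS; rewrite mem_undup mem_pmap.
apply/mapP; exists (brows S); last by rewrite valK.
apply: hL szS; case: S => D /= /andP[pD _].
by apply: sub_all pD => r /andP[].
Qed.

End BitableauPolynomials.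

(** * Standard representations *)

Section KRSInvariants.
Variables (K : fieldType) (m n : nat) (ord : rel 'X_{1..m * n}).
Hypotheses (ord_term : term_order ord) (ord_diag : diagonal K ord).
Local Notation KX := {mpoly K[m * n]}.
Local Notation bitab := (bitableau m n).
Implicit Types (S T D : bitab) (f g : KX) (P : pred bitab).

Definition nboxes S : nat := size (flatten S).

Definition std_span P : KX -> Prop :=
  lin_span (fun g => exists2 S : bitab, standard S /\ P S & g = bpoly K S).

Lemma std_reprP P f :
  std_span P f <-> exists s c, std_repr f s c /\ forall S, S \in s -> P S.
Proof.
split=> [/lin_span_family[s [c [us sP fE]]]|[s [c [[us sc ->] sP]]]].
  by exists s, c; split; [split=> // S /sP[[? _] ?]|move=> S /sP[[]]].
apply: lin_span_sum => S Ss; apply/lin_spanZ/lin_span_gen.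
by exists S => //; have [? _] := sc S Ss; split; rewrite ?sP.
Qed.

Lemma sum_seq_tnth (T : choiceType) (V : lmodType K) (s L : seq T) c
    (phi : T -> V) :
  uniq s -> uniq L -> {subset s <= L} ->
  \sum_(t <- s) c t *: phi t =
  \sum_i (let t := tnth (in_tuple L) i in if t \in s then c t else 0) *:
    phi (tnth (in_tuple L) i).
Proof.
move=> us uL sL.
rewrite -(big_tnth _ _ L xpredT (fun t => (if t \in s then c t else 0) *: phi t)).
rewrite [RHS](bigID (mem s)) /= [X in _ + X]big1 ?addr0; last first.
  by move=> t /negPf->; rewrite scale0r.
transitivity (\sum_(t <- s) (if t \in s then c t else 0) *: phi t).
  by apply: eq_big_seq => t ->.
rewrite -[RHS]big_filter; apply: perm_big.
apply: uniq_perm; rewrite ?filter_uniq // => t.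
by rewrite mem_filter; case ts: (t \in s) => //=; rewrite sL.
Qed.

(** Bitableaux are homogeneous, so the terms of any other degree sum to 0. *)
Lemma homog_repr f s c e : f \is e.-homog -> std_repr f s c ->
  std_repr f [seq S <- s | nboxes S == e] c.
Proof.
move=> hf [us sc fE]; split; first by rewrite filter_uniq.
  by move=> S; rewrite mem_filter => /andP[_ /sc].
rewrite -(pihomog_dE hf) fE raddf_sum big_filter [RHS]big_mkcond /=.
apply: eq_bigr => S _; rewrite linearZ /=; case: eqP => [<-|/eqP ne].
  by rewrite pihomog_dE //; exact: bpoly_homog.
by rewrite (pihomog_ne0 (d := size (flatten S))) ?scaler0 //; exact: bpoly_homog.
Qed.

(** What an invariant F provides for P S := (k <= F S): the bitableaux D_S of the
    triangularity argument. *)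
Definition krs_closed P := forall S, standard S -> P S ->
  exists D, [/\ init_mon ord (bpoly K D) = krs S, P D & std_span P (bpoly K D)].

Lemma std_bounded_seq P d : exists L : seq bitab, uniq L /\
  forall S, (S \in L) = [&& standard S, P S & (nboxes S <= d)%N].
Proof.
have [L [uL hL]] := bounded_bitableaux m n d.
exists [seq S : bitab <- L | [&& standard S, P S & (nboxes S <= d)%N]].
rewrite filter_uniq //; split=> // S; rewrite mem_filter.
by apply/idP/idP => [/andP[]|h] //; rewrite h hL //; case/and3P: h.
Qed.

(** The list L contains all standard bitableaux with P of degree at most d, so the
    matrix from the D_S to the S in L is square; the D_S are free because KRS is
    injective. *)
Lemma krs_triangular P (L : seq bitab) d : krs_closed P -> uniq L ->
    (forall S, (S \in L) = [&& standard S, P S & (nboxes S <= d)%N]) ->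
  let L_ := tnth (in_tuple L) in
  free_family (fun i => bpoly K (L_ i)) /\
  exists (D : 'I_(size L) -> bitab) (B : 'I_(size L) -> 'I_(size L) -> K),
    [/\ forall i, init_mon ord (bpoly K (D i)) = krs (L_ i), forall i, P (D i) &
        forall i, bpoly K (L_ i) = \sum_j B i j *: bpoly K (D j)].
Proof.
move=> closP uL LP L_.
have LLP i : [&& standard (L_ i), P (L_ i) & (nboxes (L_ i) <= d)%N].
  by rewrite -LP mem_tnth.
have [D hD] : exists D : 'I_(size L) -> bitab, forall i,
    [/\ init_mon ord (bpoly K (D i)) = krs (L_ i), P (D i) &
        std_span P (bpoly K (D i))].
  apply: (@fin_all_exists _ (fun=> bitab) (fun i D =>
    [/\ init_mon ord (bpoly K D) = krs (L_ i), P D & std_span P (bpoly K D)])) => i.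
  by have /and3P[stdL PL _] := LLP i; exact: closP.
have [A hA] : exists A : 'I_(size L) -> 'I_(size L) -> K, forall i,
    bpoly K (D i) = \sum_j A i j *: bpoly K (L_ j).
  apply: (@fin_all_exists _ (fun=> 'I_(size L) -> K) (fun i a =>
    bpoly K (D i) = \sum_j a j *: bpoly K (L_ j))) => i.
  have [initD _ /std_reprP[s [c [rDi sP]]]] := hD i.
  have /and3P[stdL PL szL] := LLP i.
  have szD : size (flatten (D i)) = nboxes (L_ i).
    rewrite /nboxes -(mdeg_init_bpoly _ ord_term ord_diag) initD mdeg_krs //.
    exact: standard_tabP.
  have [us sc DE] := homog_repr (bpoly_homog K (D i)) rDi.
  exists (fun j => let t := L_ j in
    if t \in [seq S <- s | nboxes S == nboxes (D i)]
    then c t else 0).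
  rewrite {1}DE; apply: sum_seq_tnth => // S Ss; rewrite LP.
  have [stdS _] := sc S Ss; move: Ss.
  rewrite mem_filter stdS szD => /andP[/eqP-> /sP->].
  by rewrite szL.
have freeD : free_family (fun i => bpoly K (D i)).
  move=> u u0 i; apply/eqP; apply: contraT => ui.
  have [||j [_]] := init_mon_comb ord_term (p := fun i => bpoly K (D i)) (u := u)
    _ _ (ex_intro _ i ui).
  - by move=> j; exact: bpoly_neq0 ord_diag.
  - move=> j k; have [-> _ _] := hD j; have [-> _ _] := hD k.
    have /and3P[sj _ _] := LLP j; have /and3P[sk _ _] := LLP k.
    by move/(krs_inj sj sk); exact/(tuple_uniqP (in_tuple L)).
  by rewrite u0 eqxx.
have [freeL [B hB]] := free_family_basis freeD hA.
by split=> //; exists D, B; split=> // i; have [] := hD i.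
Qed.

Lemma std_repr_support f s c s' c' : krs_closed predT ->
  std_repr f s c -> std_repr f s' c' -> {subset s <= s'}.
Proof.
move=> clos [us sc fE] [us' sc' fE'].
pose d := \max_(S <- s ++ s') nboxes S.
have [L [uL hL]] := std_bounded_seq predT d.
have szd S : S \in s ++ s' -> (nboxes S <= d)%N.
  by move=> Ss; exact: (bigmaxn_sup_seq S).
have sL : {subset s <= L}.
  by move=> S Ss; rewrite hL (proj1 (sc S Ss)) szd ?mem_cat ?Ss.
have s'L : {subset s' <= L}.
  by move=> S Ss; rewrite hL (proj1 (sc' S Ss)) szd ?mem_cat ?Ss ?orbT.
have [freeL _] := krs_triangular clos uL hL.
have := fE; rewrite fE' (sum_seq_tnth _ _ us uL sL) (sum_seq_tnth _ _ us' uL s'L).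
move/eqP; rewrite -subr_eq0 -sumrB => /eqP.
under eq_bigr => i _ do rewrite -scalerBl.
move/freeL => e S Ss; apply: contraT => Ss'.
have /tnthP[i SE] : S \in in_tuple L by exact: sL.
have := e i; rewrite /= -SE Ss (negPf Ss') => /eqP.
by rewrite subr_eq0 eq_sym; have [_ /negPf->] := sc S Ss.
Qed.

(** The D_S span the same space as the S and have distinct initial monomials. *)
Lemma init_std_span P f : krs_closed P -> std_span P f -> f != 0 ->
  exists S D, [/\ standard S, P S, P D, init_mon ord f = krs S &
                  init_mon ord f = init_mon ord (bpoly K D)].
Proof.
move=> clos /std_reprP[s [c [[us sc fE] sP]]] f0.
have [L [uL hL]] := std_bounded_seq P (\max_(S <- s) nboxes S).
have sL : {subset s <= L}.
  move=> S Ss; rewrite hL (proj1 (sc S Ss)) sP //=.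
  exact: (bigmaxn_sup_seq S).
have [_ [D [B [initD PD LE]]]] := krs_triangular clos uL hL.
set L_ := tnth (in_tuple L) in initD LE.
pose u j := \sum_i (if L_ i \in s then c (L_ i) else 0) * B i j.
have fE' : f = \sum_j u j *: bpoly K (D j).
  rewrite fE (sum_seq_tnth _ _ us uL sL) /=.
  under eq_bigr => i _ do rewrite LE scaler_sumr.
  rewrite exchange_big; apply: eq_bigr => j _; rewrite /u scaler_suml.
  by apply: eq_bigr => i _; rewrite scalerA.
have LLP i : [&& standard (L_ i), P (L_ i) & (nboxes (L_ i) <=
    \max_(S <- s) nboxes S)%N] by rewrite -hL mem_tnth.
have [|||i [_ _ fi]] :=
    init_mon_comb ord_term (p := fun i => bpoly K (D i)) (u := u).
- by move=> j; exact: bpoly_neq0 ord_diag.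
- move=> j k; rewrite !initD.
  have /and3P[sj _ _] := LLP j; have /and3P[sk _ _] := LLP k.
  by move/(krs_inj sj sk); exact/(tuple_uniqP (in_tuple L)).
- apply/existsP; apply: contraNT f0; rewrite negb_exists => /forallP u0.
  rewrite fE' big1 // => j _; have /negPn/eqP-> := u0 j.
  by rewrite scale0r.
have /and3P[stdL PL _] := LLP i.
by exists (L_ i), (D i); rewrite fE' fi; split.
Qed.

End KRSInvariants.

(** * The ideal of a KRS-invariant *)

Theorem proposition4p7 (K : fieldType) (m n : nat) (ord : rel 'X_{1..m * n})
    (ord_term : term_order ord) (ord_diag : diagonal K ord)
    (F : bitableau m n -> nat) (F_inv : KRS_invariant K ord F) (k : int) :
  (has_standard_basis (KRS_ideal K F k) /\
   (forall S : bitableau m n, standard S ->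
      (KRS_ideal K F k (bpoly K S) <-> k <= (F S)%:Z))) /\
  G_KRS ord (KRS_ideal K F k).
Proof.
have [F1 F2 F3] := F_inv.
pose P : pred (bitableau m n) := fun S => k <= (F S)%:Z.
set I := KRS_ideal K F k.
have std_all (f : {mpoly K[m * n]}) : std_span predT f.
  rewrite [f]mpolyE; apply: lin_span_sum => M _; apply: lin_spanZ.
  have [D <-] := mpolyX_bitableau K M.
  have [[S [[s [c [r _]]] _]] _] := F1 D.
  by apply/std_reprP; exists s, c.
have closP : krs_closed K ord P.
  move=> S stdS PS; have [[D [initD FD]] _] := F3 S stdS.
  exists D; split=> //; first by rewrite /P FD.
  have /std_reprP[s [c [r _]]] := std_all (bpoly K D).
  apply/std_reprP; exists s, c; split=> // T Ts; rewrite /P.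
  apply: Order.POrderTheory.le_trans PS _; rewrite lez_nat -FD.
  by have [_ ->] := F1 D => //; exists s, c.
have closT : krs_closed K ord predT.
  move=> S stdS _; have [[D [initD FD]] _] := F3 S stdS.
  by exists D; split.
have IP f : I f <-> std_span P f.
  split=> [[s sD ->]|[s sS ->]].
    apply: lin_span_sum => x /sD[D [kD ->]].
    have /std_reprP[t [c [r _]]] := std_all (x.1 * bpoly K D).
    apply/std_reprP; exists t, c; split=> // T Tt; rewrite /P.
    apply: Order.POrderTheory.le_trans kD _; rewrite lez_nat.
    by apply: (F2 D T x.1); exists t, c.
  exists [seq (x.1%:MP, x.2) | x <- s].
    by move=> _ /mapP[x /sS[S [_ PS] xE] ->]; exists S.
  by rewrite big_map; apply: eq_bigr => x _; rewrite mul_mpolyC.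
(* A standard representation of f in I is unique, so it is the one in which
   all bitableaux satisfy P. *)
have reprP f s c : I f -> std_repr f s c -> forall S, S \in s -> P S.
  move=> /IP/std_reprP[s' [c' [r' sP]]] r S Ss.
  exact: sP (std_repr_support ord_term ord_diag closT r r' Ss).
have IS (S : bitableau m n) : standard S -> I (bpoly K S) <-> P S.
  move=> stdS; split=> [IS|PS].
    apply: (reprP _ [:: S] (fun=> 1) IS); last exact: mem_head.
    split=> //; last by rewrite big_seq1 scale1r.
    by move=> T; rewrite inE => /eqP->; split=> //; exact: oner_neq0.
  by apply/IP/lin_span_gen; exists S.
have basis : has_standard_basis I.
  move=> f; split=> [/IP|h].
    apply: lin_span_sub => _ [S [stdS PS] ->]; exists S; split=> //.
    exact/IS.
  apply/IP; apply: lin_span_sub h => _ [S [stdS IbS ->]]; exists S => //.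
  by split=> //; exact/IS.
have ID D : P D -> I (bpoly K D).
  move=> kD; exists [:: (1, bpoly K D)]; last by rewrite big_seq1 mul1r.
  by move=> x; rewrite inE => /eqP->; exists D.
have initI f : I f -> f != 0 -> exists S D : bitableau m n,
  [/\ standard S, P S, P D,
    init_mon ord f = krs S & init_mon ord f = init_mon ord (bpoly K D)].
  by move=> /IP; exact: (init_std_span ord_term ord_diag closP).
(* Both in(I) and KRS(I) are the span of the monomials KRS(S) with P S. *)
split=> //; split; first split=> // g.
  split=> [[s sP ->]|[f [If [s [c [r ->]]]]]].
    have : lin_span (fun g => exists2 S : bitableau m n, standard S /\ P S &
        g = 'X_[krs S]) (\sum_(x <- s) x.1 * x.2).
      apply: lin_span_sum => x /sP[f [If f0 ->]].
      rewrite [x.1]mpolyE mulr_suml; apply: lin_span_sum => M _.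
      rewrite -scalerAl -mpolyXD -(init_monMX ord_term) //.
      apply/lin_spanZ/lin_span_gen.
      have [||S [_ [stdS PS _ -> _]]] := initI (f * 'X_[M]); last by exists S.
        apply/IP; have [t tP ->] := If; rewrite mulr_suml.
        apply: lin_span_sum => y /tP yP; apply/IP.
        exists [:: (y.1 * 'X_[M], y.2)]; last by rewrite big_seq1 mulrAC.
        by move=> z; rewrite inE => /eqP->.
      by rewrite mulf_neq0 // -msupp_eq0 msuppX.
    case/lin_span_family => t [c [ut tP gE]].
    exists (\sum_(S <- t) c S *: bpoly K S); split; last first.
      by exists t, c; split=> //; split=> // S /tP[[]].
    apply/IP/std_reprP; exists t, c; split; last by move=> S /tP[[]].
    by split=> // S /tP[[]].
  exists [seq ((c t)%:MP, 'X_[krs (brows t)]) | t <- s]; last first.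
    by rewrite big_map; apply: eq_bigr => S _; rewrite mul_mpolyC.
  move=> _ /mapP[S Ss ->]; have PS := reprP _ _ _ If r S Ss.
  have [_ /(_ _ Ss)[stdS _] _] := r; have [D [initD PD _]] := closP S stdS PS.
  exists (bpoly K D); rewrite initD; split=> //; first exact: ID.
  exact: bpoly_neq0 ord_diag.
split=> [_ [D [ID' ->]] //|f].
(* The generators of in(I) are already initial monomials of bitableaux. *)
split=> -[s sP ->]; exists s => // x /sP[g [Ig g0 ->]].
  have [_ [D [_ _ PD _ ->]]] := initI g Ig g0.
  exists (bpoly K D); split=> //; last exact: bpoly_neq0 ord_diag.
  by exists D; split=> //; exact: ID.
by case: Ig g0 => D [IbD ->] D0; exists (bpoly K D).
Qed.
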